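(* For every $0\le i\le n$, $$G_i\!\left(\frac{c-1}{z^{\delta_{i0}}\varepsilon_i(x)}\right) M(x,z)\, G_i\!\left(\frac{c^{-1}-1}{z^{\delta_{i0}}\varphi_i(x)}\right)=M(e_i^c(x),z),$$ as an identity of $2n\times 2n$ matrices of rational functions in $x=(x_1,\dots,x_n,\bar x_{n-1},\dots,\bar x_1)$, the parameter $c$ and the spectral parameter $z$.
   Context: Let $n\ge 4$. Variables are real; all maps and identities are rational (identities hold wherever both sides are defined); $\delta_{ij}$ is the Kronecker delta; empty products are $1$. **The geometric $D^{(1)}_n$-crystal $\mathcal B$.** Variables $x=(x_1,\dots,x_n,\bar x_{n-1},\dots,\bar x_1)$. Functions: $\varepsilon_0(x)=x_1(\frac{x_2}{\bar x_2}+1)$, $\varphi_0(x)=\bar x_1(\frac{\bar x_2}{x_2}+1)$; $\varepsilon_i(x)=\bar x_i(\frac{x_{i+1}}{\bar x_{i+1}}+1)$, $\varphi_i(x)=x_i(\frac{\bar x_{i+1}}{x_{i+1}}+1)$ for $1\le i\le n-2$; $\varepsilon_{n-1}(x)=x_n\bar x_{n-1}$, $\varphi_{n-1}(x)=x_{n-1}$; $\varepsilon_n(x)=\bar x_{n-1}$, $\varphi_n(x)=x_{n-1}x_n$. With $\xi_i=\frac{x_i+c\bar x_i}{x_i+\bar x_i}$, the map $e_i^c$ changes only the listed coordinates: $e_0^c$: $x_1\mapsto\xi_2^{-1}x_1$, $x_2\mapsto c^{-1}\xi_2x_2$, $\bar x_2\mapsto\xi_2\bar x_2$, $\bar x_1\mapsto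 c\xi_2^{-1}\bar x_1$; $e_i^c$ ($1\le i\le n-2$): $x_i\mapsto c\xi_{i+1}^{-1}x_i$, $x_{i+1}\mapsto c^{-1}\xi_{i+1}x_{i+1}$, $\bar x_{i+1}\mapsto\xi_{i+1}\bar x_{i+1}$, $\bar x_i\mapsto\xi_{i+1}^{-1}\bar x_i$; $e_{n-1}^c$: $x_{n-1}\mapsto cx_{n-1}$, $x_n\mapsto c^{-1}x_n$; $e_n^c$: $x_n\mapsto cx_n$, $\bar x_{n-1}\mapsto c^{-1}\bar x_{n-1}$. The level is $\ell(x)=x_1\cdots x_n\bar x_{n-1}\cdots\bar x_1$. **The matrices $G_i(a)$.** $E$ is the $2n\times2n$ identity, $E_{ij}$ matrix units. $G_i(a)=E+a(E_{i,i+1}+E_{2n-i,2n+1-i})$ for $1\le i\le n-1$, $G_n(a)=E+a(E_{n-1,n+1}+E_{n,n+2})$, $G_0(a)=E+a(E_{2n-1,1}+E_{2n,2})$. **The $2n\times 2n$ matrix $M(x,z)$.** Write $M_{i,j}=M(x,z)_{i,j}$, $\ell=\ell(x)$, $\bar X_i=1+\bar x_i/x_i$. First column: $M_{1,1}=x_1/\bar x_1$; $M_{i,1}=x_1\cdots x_{i-1}(1+x_i/\bar x_i)$ for $2\le i\le n-1$; $M_{n,1}=x_1\cdots x_n$; $M_{n+1,1}=x_1\cdots x_{n-1}$; $M_{i,1}=\ell/(\bar x_1\cdots\bar x_{2n-i})$ for $n+2\le i\le 2n$. Other columns ($1\le i\le 2n$): $M_{i,j+1}=\frac{M_{i,j}}{x_j}+(\ell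 z-1)\big(\frac{\delta_{i,j}}{\bar x_j}+\delta_{i,j+1}\big)$ for $1\le j\le n-2$; $M_{i,n}=\frac{M_{i,n-1}}{x_{n-1}}+(\ell z-1)\big(\frac{\delta_{i,n-1}}{\bar x_{n-1}}+\delta_{i,n+1}\big)$; $M_{i,n+1}=\frac{M_{i,n-1}}{x_{n-1}x_n}+(\ell z-1)\big(\frac{\delta_{i,n-1}}{\bar x_{n-1}x_n}+\delta_{i,n}\big)$; $M_{i,2n}=z\frac{\bar x_1}{x_1}M_{i,1}+\delta_{i,2n}\frac{\bar x_1}{x_1}(1-\ell z)+\delta_{i,1}z(\ell z-1)$; $M_{i,2n-1}=z\bar x_1\bar X_2M_{i,1}+(1-\ell z)\big(\delta_{i,2n}\bar x_1\bar X_2+\delta_{i,2n-1}\frac{\bar x_2}{x_2}\big)$; $M_{i,2n-j}=\bar x_j\frac{\bar X_{j+1}}{\bar X_j}M_{i,2n+1-j}+(1-\ell z)\big(\delta_{i,2n+1-j}\bar x_j\frac{\bar X_{j+1}}{\bar X_j}+\delta_{i,2n-j}\frac{\bar x_{j+1}}{x_{j+1}}\big)$ for $2\le j\le n-2$. *)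

(* Defs.v *)
From mathcomp Require Import all_boot all_order all_algebra.
From mathcomp Require Import zify.

Set Implicit Arguments.
Unset Strict Implicit.
Unset Printing Implicit Defensive.

Import GRing.Theory.
Local Open Scope ring_scope.

(* A point x = (x_1, ..., x_n, xbar_(n-1), ..., xbar_1), in this order.
   All indices below are 1-based natural numbers. *)
Definition point (F : fieldType) (n : nat) := ((2 * n - 1)%N).-tuple F.

Definition xc (F : fieldType) (n : nat) (x : point F n) (j : nat) : F :=
  nth 0 (tval x) j.-1.

Definition xb (F : fieldType) (n : nat) (x : point F n) (j : nat) : F :=
  nth 0 (tval x) (2 * n - 1 - j).

(* The point with x_j = f j for 1 <= j <= n and xbar_j = g j for 1 <= j < n. *)
Definition mkpoint (F : fieldType) (n : nat) (f g : nat -> F) : point F n :=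
  [tuple if (k < n)%N then f k.+1 else g (2 * n - 1 - k)%N
  | k < (2 * n - 1)%N].

Lemma xc_mkpoint (F : fieldType) (n : nat) (f g : nat -> F) (j : nat) :
  (1 <= j <= n)%N -> xc (mkpoint n f g) j = f j.
Proof.
move=> hj; have lt2 : (j.-1 < 2 * n - 1)%N by lia.
rewrite /xc -[j.-1]/(nat_of_ord (Ordinal lt2)) -tnth_nth tnth_mktuple /=.
by rewrite ifT ?prednK //; lia.
Qed.

Lemma xb_mkpoint (F : fieldType) (n : nat) (f g : nat -> F) (j : nat) :
  (1 <= j <= n - 1)%N -> xb (mkpoint n f g) j = g j.
Proof.
move=> hj; have lt2 : (2 * n - 1 - j < 2 * n - 1)%N by lia.
rewrite /xb -[(2 * n - 1 - j)%N]/(nat_of_ord (Ordinal lt2)) -tnth_nth.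
by rewrite tnth_mktuple /= ifF ?subKn //; lia.
Qed.

Definition epsilon (F : fieldType) (n i : nat) (x : point F n) : F :=
  if i == 0%N then xc x 1 * (xc x 2 / xb x 2 + 1)
  else if (i <= n - 2)%N then xb x i * (xc x i.+1 / xb x i.+1 + 1)
  else if i == (n - 1)%N then xc x n * xb x (n - 1)
  else xb x (n - 1).

Definition phi (F : fieldType) (n i : nat) (x : point F n) : F :=
  if i == 0%N then xb x 1 * (xb x 2 / xc x 2 + 1)
  else if (i <= n - 2)%N then xc x i * (xb x i.+1 / xc x i.+1 + 1)
  else if i == (n - 1)%N then xc x (n - 1)
  else xc x (n - 1) * xc x n.

Definition xi (F : fieldType) (n : nat) (c : F) (x : point F n) (j : nat) : F :=
  (xc x j + c * xb x j) / (xc x j + xb x j).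

(* e_i^c for 0 <= i <= n. *)
Definition geom_e (F : fieldType) (n i : nat) (c : F) (x : point F n) :
    point F n :=
  if i == 0%N then
    mkpoint n
      [eta xc x with 1%N |-> (xi c x 2)^-1 * xc x 1,
                     2%N |-> c^-1 * xi c x 2 * xc x 2]
      [eta xb x with 1%N |-> c * (xi c x 2)^-1 * xb x 1,
                     2%N |-> xi c x 2 * xb x 2]
  else if (i <= n - 2)%N then
    mkpoint n
      [eta xc x with i    |-> c * (xi c x i.+1)^-1 * xc x i,
                     i.+1 |-> c^-1 * xi c x i.+1 * xc x i.+1]
      [eta xb x with i    |-> (xi c x i.+1)^-1 * xb x i,
                     i.+1 |-> xi c x i.+1 * xb x i.+1]
  else if i == (n - 1)%N then
    mkpoint n
      [eta xc x with (n - 1)%N |-> c * xc x (n - 1), n |-> c^-1 * xc x n]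
      (xb x)
  else
    mkpoint n
      [eta xc x with n |-> c * xc x n]
      [eta xb x with (n - 1)%N |-> c^-1 * xb x (n - 1)].

Definition level (F : fieldType) (n : nat) (x : point F n) : F :=
  (\prod_(1 <= k < n.+1) xc x k) * (\prod_(1 <= k < n) xb x k).

Definition kd (F : fieldType) (i j : nat) : F := (i == j)%:R.
Arguments kd F i j : clear implicits.

(* The matrix unit E_(p,q), with 1-based p and q. *)
Definition Eunit (F : fieldType) (n p q : nat) : 'M[F]_(2 * n) :=
  \matrix_(i, j) (kd F i.+1 p * kd F j.+1 q).
Arguments Eunit F n p q : clear implicits.

Definition G (F : fieldType) (n i : nat) (a : F) : 'M[F]_(2 * n) :=
  if i == 0%N then
    1%:M + a *: (Eunit F n (2 * n - 1) 1 + Eunit F n (2 * n) 2)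
  else if (i < n)%N then
    1%:M + a *: (Eunit F n i i.+1 + Eunit F n (2 * n - i) (2 * n + 1 - i))
  else
    1%:M + a *: (Eunit F n (n - 1) (n + 1) + Eunit F n n (n + 2)).

Definition barX (F : fieldType) (n : nat) (x : point F n) (j : nat) : F :=
  1 + xb x j / xc x j.

Definition Mcol1 (F : fieldType) (n : nat) (x : point F n) (i : nat) : F :=
  if i == 1%N then xc x 1 / xb x 1
  else if (i <= n - 1)%N then
    (\prod_(1 <= k < i) xc x k) * (1 + xc x i / xb x i)
  else if i == n then \prod_(1 <= k < n.+1) xc x k
  else if i == (n + 1)%N then \prod_(1 <= k < n) xc x k
  else level x / \prod_(1 <= k < (2 * n - i).+1) xb x k.

(* M_(i,j) for 1 <= j <= n - 1. *)
Fixpoint Mleft (F : fieldType) (n : nat) (x : point F n) (z : F) (i j : nat)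
    {struct j} : F :=
  match j with
  | 0 => 0
  | 1 => Mcol1 x i
  | (j'.+1 as k).+1 =>
      Mleft x z i k / xc x k
      + (level x * z - 1) * (kd F i k / xb x k + kd F i k.+1)
  end.

(* M_(i,2n-k) for 0 <= k <= n - 2. *)
Fixpoint Mright (F : fieldType) (n : nat) (x : point F n) (z : F) (i k : nat)
    {struct k} : F :=
  match k with
  | 0 =>
      z * (xb x 1 / xc x 1) * Mcol1 x i
      + kd F i (2 * n) * (xb x 1 / xc x 1) * (1 - level x * z)
      + kd F i 1 * z * (level x * z - 1)
  | 1 =>
      z * xb x 1 * barX x 2 * Mcol1 x i
      + (1 - level x * z) *
        (kd F i (2 * n) * xb x 1 * barX x 2
         + kd F i (2 * n - 1) * (xb x 2 / xc x 2))
  | (j'.+1 as j).+1 =>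
      xb x k * (barX x k.+1 / barX x k) * Mright x z i j
      + (1 - level x * z) *
        (kd F i (2 * n + 1 - k) * xb x k * (barX x k.+1 / barX x k)
         + kd F i (2 * n - k) * (xb x k.+1 / xc x k.+1))
  end.

Definition Mentry (F : fieldType) (n : nat) (x : point F n) (z : F)
    (i j : nat) : F :=
  if (j <= n - 1)%N then Mleft x z i j
  else if j == n then
    Mleft x z i (n - 1) / xc x (n - 1)
    + (level x * z - 1) *
      (kd F i (n - 1) / xb x (n - 1) + kd F i (n + 1))
  else if j == (n + 1)%N then
    Mleft x z i (n - 1) / (xc x (n - 1) * xc x n)
    + (level x * z - 1) *
      (kd F i (n - 1) / (xb x (n - 1) * xc x n) + kd F i n)
  else Mright x z i (2 * n - j).

Definition M (F : fieldType) (n : nat) (x : point F n) (z : F) :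
    'M[F]_(2 * n) :=
  \matrix_(i, j) Mentry x z i.+1 j.+1.

(* Domains of definition of the rational expressions above: the denominators
   occurring in M(x,z) (only the barX_j with 2 <= j <= n - 2 are inverted). *)
Definition M_defined (F : fieldType) (n : nat) (x : point F n) : Prop :=
  [/\ forall j, (1 <= j <= n)%N -> xc x j != 0,
      forall j, (1 <= j <= n - 1)%N -> xb x j != 0
    & forall j, (2 <= j <= n - 2)%N -> barX x j != 0].

(* The denominators occurring in e_i^c(x): c always, and, for i <= n - 2, the
   denominator of xi_m and xi_m itself, where m = 2 if i = 0 and m = i + 1
   otherwise. *)
Definition e_defined (F : fieldType) (n i : nat) (c : F) (x : point F n) :
    Prop :=
  c != 0 /\
  ((i <= n - 2)%N ->
   let m := if i == 0%N then 2%N else i.+1 in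
   xc x m + xb x m != 0 /\ xi c x m != 0).

(* Main.v *)
Require Import Defs.
From mathcomp Require Import all_boot all_order all_algebra.
From mathcomp Require Import zify ring.

(** Put [u = level x * z - 1], so that [1 + u = level x * z].  Solving the
    recursions for the columns shows that M(x,z) is a rank-one matrix
    [v_k * w_j] in which every entry strictly above the diagonal is multiplied
    by [1 + u], plus [u] times a sparse correction that does not depend on x
    ([M_ordform]).  Above the diagonal is meant for the partial order
    1 < ... < n-1 < {n, n+1} < n+2 < ... < 2n in which n and n+1 are
    incomparable, the order of the weights of the vector representation of D_n.
    Here v is the first column of M, and the entries of v and of w are products
    of coordinates or of their inverses, times a factor that depends on one pair
    (x_j, xbar_j) only.

    The operator e_i^c preserves the level, hence u.  If i >= 1, it rescales
    coordinates at two adjacent sites in such a way that the new v and w are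
    exactly [G v] and [w G'], where G and G' are the two transvections of the
    statement.  The rank-one part is therefore transported correctly, and only
    the order pattern and the correction have to be compared.  Away from the
    four indices p, q, r, t moved by G nothing happens, because p and q (and
    likewise r and t) compare in the same way with every other index.  What
    remains are two scalar identities, one for each of the pairs (p,q) and
    (r,t), and the value of the correction at (q,r), which is nonzero
    when q and r are the incomparable pair.  This is
    [ordform_transvections]; it covers at once the chains
    p < q < r < t coming from i <= n-2 and the diamonds p < {q, r} < t coming
    from i = n-1 and i = n.

    For i = 0, [G_0] adds multiples of rows 1 and 2 to rows 2n-1 and 2n.  The
    matrix keeps its shape when the indices 1 and 2 are moved behind 2n: with
    v_1, v_2 multiplied by [level x * z] and w_1, w_2 divided by it, the new
    order is 3 < ... < 2n-1 < {2n, 1} < 2 ([M_ordform_turn]).  In this order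
    the indices 2n-1, 1, 2n, 2 form a diamond, and the general argument
    applies again, v and w being now transported up to the factors c and
    1/c. *)

Set Implicit Arguments.
Unset Strict Implicit.
Unset Printing Implicit Defensive.

Import GRing.Theory.
Local Open Scope ring_scope.

(** * Transvections acting on order-shaped matrices *)

Section Transvections.
Variable F : fieldType.
Implicit Types (f J : nat -> nat -> F) (v w : nat -> F).

Definition rowop (p q r t : nat) (a : F) f (k j : nat) : F :=
  f k j + a * ((k == p)%:R * f q j + (k == r)%:R * f t j).

Definition colop (p q r t : nat) (b : F) f (k j : nat) : F :=
  f k j + b * ((j == q)%:R * f k p + (j == t)%:R * f k r).

(** Matrices are described by functions of 1-based indices, as in the
    definition of M; this avoids arithmetic on ordinals. *)
Lemma Eunit_mulmx n p q f : (1 <= q <= 2 * n)%N ->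
  Eunit F n p q *m (\matrix_(k < 2 * n, j < 2 * n) f k.+1 j.+1)
  = \matrix_(k < 2 * n, j < 2 * n) ((k.+1 == p)%:R * f q j.+1).
Proof.
move=> hq; have lq : (q.-1 < 2 * n)%N by lia.
apply/matrixP=> k j; rewrite !mxE (bigD1 (Ordinal lq)) //= !mxE /= big1.
  by rewrite /kd prednK ?eqxx ?mulr1 ?addr0 //; lia.
move=> m; rewrite -val_eqE /= => hm; rewrite !mxE /kd.
by have /negPf-> : m.+1 != q; [lia | rewrite mulr0 mul0r].
Qed.

Lemma mulmx_Eunit n p q f : (1 <= p <= 2 * n)%N ->
  (\matrix_(k < 2 * n, j < 2 * n) f k.+1 j.+1) *m Eunit F n p q
  = \matrix_(k < 2 * n, j < 2 * n) ((j.+1 == q)%:R * f k.+1 p).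
Proof.
move=> hp; have lp : (p.-1 < 2 * n)%N by lia.
apply/matrixP=> k j; rewrite !mxE (bigD1 (Ordinal lp)) //= !mxE /= big1.
  by rewrite /kd prednK ?eqxx ?mul1r ?addr0 1?mulrC //; lia.
move=> m; rewrite -val_eqE /= => hm; rewrite !mxE /kd.
by have /negPf-> : m.+1 != p; [lia | rewrite mul0r mulr0].
Qed.

Lemma transvections_mulmx n p q r t a b f :
  (1 <= p <= 2 * n)%N -> (1 <= q <= 2 * n)%N ->
  (1 <= r <= 2 * n)%N -> (1 <= t <= 2 * n)%N ->
  (1%:M + a *: (Eunit F n p q + Eunit F n r t))
    *m (\matrix_(k < 2 * n, j < 2 * n) f k.+1 j.+1)
    *m (1%:M + b *: (Eunit F n p q + Eunit F n r t))
  = \matrix_(k < 2 * n, j < 2 * n)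
      colop p q r t b (rowop p q r t a f) k.+1 j.+1.
Proof.
move=> hp hq hr ht.
have -> : (1%:M + a *: (Eunit F n p q + Eunit F n r t))
    *m (\matrix_(k < 2 * n, j < 2 * n) f k.+1 j.+1)
  = \matrix_(k < 2 * n, j < 2 * n) rowop p q r t a f k.+1 j.+1.
  rewrite mulmxDl mul1mx -scalemxAl mulmxDl !Eunit_mulmx //.
  by apply/matrixP=> k j; rewrite !mxE.
rewrite mulmxDr mulmx1 -scalemxAr mulmxDr !mulmx_Eunit //.
by apply/matrixP=> k j; rewrite !mxE.
Qed.

(** A rank-one matrix deformed by [u] along the relation [U], with a correction
    [J] that also vanishes with [u]. *)
Definition ordform (u : F) v w (U : rel nat) J (k j : nat) : F :=
  v k * w j * (1 + u * (U k j)%:R) + u * J k j.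

(** What the transvection 1 + a(E_pq + E_rt) needs from the order [U] and the
    correction [J]: [p] and [q], as well as [r] and [t], cannot be told apart by
    any other index, except that [q] and [r] may be incomparable; hence the
    exclusion of [q] in the second and of [r] in the third of the last four
    clauses. *)
Definition adapted (D : pred nat) (U : rel nat) J (p q r t : nat) : Prop :=
  [/\ [/\ p \in D, q \in D, r \in D & t \in D],
      uniq [:: p; q; r; t],
      [/\ U p q, U p r, U p t, U q t & U r t]
        /\ {in [:: p; q; r; t], forall m, ~~ U m m},
      [/\ ~~ U r p, ~~ U r q, ~~ U t p & ~~ U t q]
        /\ [/\ J p r = 0, J q t = 0, J r p = 0 & J t q = 0]
    & {in D, forall m,
        [/\ m != p -> m != r -> U m p = U m q /\ J m p = 0,
            m != p -> m != r -> m != q -> U m r = U m t /\ J m r = 0,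
            m != q -> m != t -> m != r -> U q m = U p m /\ J q m = 0
          & m != q -> m != t -> U t m = U r m /\ J t m = 0]}].

(** Let v' and w' be the transvected vectors.  An entry whose row and column are
    compared alike before and after the operation is transported because the
    rank-one part is.  The exceptions are the entries (p,q) and (r,t), where a
    diagonal entry of the correction is added to a position above the diagonal,
    and those receiving a contribution of (q,r).  The two scalar hypotheses say
    that [U]-part and correction balance at (p,q) and (r,t); the hypothesis on
    [J q r] says that, in total, (q,r) behaves as if q and r were comparable. *)
Lemma ordform_transvections D U J p q r t u a b v w v' w' :
  adapted D U J p q r t ->
  J q r = (1 - (U q r)%:R) * (v q * w r) ->
  a * (J q q - v q * w q) + b * (J p p - v p * w p) = a * b * (v q * w p) ->
  a * (J t t - v t * w t) + b * (J r r - v r * w r) = a * b * (v t * w r) ->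
  {in D, forall k,
     v' k = v k + a * ((k == p)%:R * v q + (k == r)%:R * v t)} ->
  {in D, forall j,
     w' j = w j + b * ((j == q)%:R * w p + (j == t)%:R * w r)} ->
  {in D &, forall k j,
    colop p q r t b (rowop p q r t a (ordform u v w U J)) k j
    = ordform u v' w' U J k j}.
Proof.
move=> [[Dp Dq Dr Dt] uniq4 [[Upq Upr Upt Uqt Urt] Uirr]
  [[/negPf Urp /negPf Urq /negPf Utp /negPf Utq] [Jpr Jqt Jrp Jtq]] far].
have [nqp nrp ntp] : [/\ q != p, r != p & t != p].
  by move: uniq4; rewrite /= !inE; clear; split; lia.
have [nrq ntq ntr] : [/\ r != q, t != q & t != r].
  by move: uniq4; rewrite /= !inE; clear; split; lia.
have cp k Dk := let: And4 h _ _ _ := far k Dk in h.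
have cr k Dk := let: And4 _ h _ _ := far k Dk in h.
have rq k Dk := let: And4 _ _ h _ := far k Dk in h.
have rt k Dk := let: And4 _ _ _ h := far k Dk in h.
have /negPf Upp := Uirr p (mem_head _ _).
have /negPf Uqq : ~~ U q q by apply: Uirr; rewrite !inE eqxx orbT.
have /negPf Urr : ~~ U r r by apply: Uirr; rewrite !inE eqxx !orbT.
have /negPf Utt : ~~ U t t by apply: Uirr; rewrite !inE eqxx !orbT.
move=> Jqr epq ert hv hw k j Dk Dj.
have [nqr nqt nrt] : [/\ q != r, q != t & r != t].
  by rewrite ![q == _]eq_sym [r == t]eq_sym.
have [Uqp Jqp] := cp q Dq nqp nqr.
have [Utr Jtr] := cr t Dt ntp ntr ntq.
rewrite Uqq in Uqp; rewrite Utt in Utr.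
rewrite /colop /rowop /ordform (hv k Dk) (hw j Dj).
have [->|nkp] := eqVneq k p.
  rewrite eq_sym (negPf nrp).
  have [->|njq] := eqVneq j q.
    rewrite (eq_sym q) (negPf ntq) Upq Uqq Upp Uqp Jqp /=.
    (* The difference of the two sides is u times the scalar identity. *)
    set L := LHS; set R := RHS.
    have -> : L = R + u * (a * (J q q - v q * w q) + b * (J p p - v p * w p)
                    - a * b * (v q * w p)) by rewrite /L /R; ring.
    by rewrite epq subrr mulr0 addr0.
  have [->|njt] := eqVneq j t.
    rewrite Upt Uqt Upr Jpr Jqt Jqr /=; move: (U q r)%:R => e; ring.
  have [->|njr] := eqVneq j r; first by rewrite Jqr Jpr Upr /=; ring.
  by have [-> ->] := rq j Dj njq njt njr; rewrite /=; ring.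
have [->|nkr] := eqVneq k r.
  have [->|njq] := eqVneq j q.
    by rewrite (eq_sym q) (negPf ntq) Urq Utq Urp Utp Jrp Jtq
      (proj2 (cp t Dt ntp ntr)) /=; ring.
  have [->|njt] := eqVneq j t.
    rewrite Urt Utt Urr Utr Jtr /=.
    set L := LHS; set R := RHS.
    have -> : L = R + u * (a * (J t t - v t * w t) + b * (J r r - v r * w r)
                    - a * b * (v t * w r)) by rewrite /L /R; ring.
    by rewrite ert subrr mulr0 addr0.
  by have [-> ->] := rt j Dj njq njt; rewrite /=; ring.
have [->|njq] := eqVneq j q.
  rewrite (eq_sym q) (negPf ntq).
  by have [-> ->] := cp k Dk nkp nkr; rewrite /=; ring.
have [->|njt] := eqVneq j t; last by rewrite /=; ring.
have [->|nkq] := eqVneq k q; first by rewrite Jqr Jqt Uqt /=; ring.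
by have [-> ->] := cr k Dk nkp nkr nkq; rewrite /=; ring.
Qed.
End Transvections.

(** * Closed form of the matrix *)

(** Index goals depend on no hypothesis about ring elements; clearing those
    keeps the decision procedure fast. *)
Ltac index_lia :=
  repeat match goal with H : is_true (negb (_ == 0%R)) |- _ => clear H end; lia.

Definition xprod (F : fieldType) (n : nat) (x : point F n) (k : nat) : F :=
  \prod_(1 <= m < k.+1) xc x m.

Definition bprod (F : fieldType) (n : nat) (x : point F n) (k : nat) : F :=
  \prod_(1 <= m < k.+1) xb x m.

(** The row vector of the rank-one part.  The summand
    [(j < 2 * n)%:R] treats the last column, where xbar_1/x_1 occurs without the
    summand 1 of barX, together with the other columns on the right. *)
Definition colfactor (F : fieldType) (n : nat) (x : point F n) (j : nat) : F :=
  if (j <= n)%N then (xprod x j.-1)^-1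
  else if j == n.+1 then (xprod x n)^-1
  else bprod x (2 * n - j) *
    ((j < 2 * n)%:R + xb x (2 * n - j).+1 / xc x (2 * n - j).+1) / level x.

(** The order on the weights of the vector representation of D_n. *)
Definition dorder (n k j : nat) : bool :=
  (k < j)%N && ~~ ((k == n) && (j == n.+1)).

(** Diagonal positions, with the rows n and n+1 exchanged. *)
Definition dmatch (n k j : nat) : bool :=
  if (k == n) || (k == n.+1) then (k + j == n + n.+1)%N else k == j.

Definition dcorr (F : fieldType) (n : nat) (z : F) (k j : nat) : F :=
  if (k == 1%N) && (j == (2 * n)%N) then z
  else ((1 < k < 2 * n)%N && dmatch n k j)%:R.

(** A form without conditional, which [lia] can decide. *)
Lemma dmatchE n k j : dmatch n k j =
  ((k == j) && (k != n) && (k != n.+1))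
  || ((k == n) || (k == n.+1)) && (k + j == n + n.+1)%N.
Proof. by rewrite /dmatch; case: ifP => ?; lia. Qed.

Lemma dcorrE (F : fieldType) n (z : F) k j (b : bool) :
  ~~ ((k == 1%N) && (j == (2 * n)%N)) ->
  ((1 < k < 2 * n)%N && dmatch n k j) = b -> dcorr n z k j = b%:R.
Proof. by rewrite /dcorr => /negPf-> ->. Qed.

Section ClosedForm.
Variables (F : fieldType) (n : nat) (x : point F n).
Hypotheses (hn : (4 <= n)%N) (hM : M_defined x).
Implicit Types (z : F).

Lemma xc_neq0 j : (1 <= j <= n)%N -> xc x j != 0.
Proof. by case: hM => + _ _; apply. Qed.

Lemma xb_neq0 j : (1 <= j <= n - 1)%N -> xb x j != 0.
Proof. by case: hM => _ + _; apply. Qed.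

Lemma xprod0 : xprod x 0 = 1.
Proof. by rewrite /xprod big_geq. Qed.

Lemma bprod0 : bprod x 0 = 1.
Proof. by rewrite /bprod big_geq. Qed.

Lemma xprodS k : xprod x k.+1 = xprod x k * xc x k.+1.
Proof. by rewrite /xprod big_nat_recr. Qed.

Lemma bprodS k : bprod x k.+1 = bprod x k * xb x k.+1.
Proof. by rewrite /bprod big_nat_recr. Qed.

Lemma xprod_neq0 k : (k <= n)%N -> xprod x k != 0.
Proof.
elim: k => [|k IH] hk; first by rewrite xprod0 oner_neq0.
by rewrite xprodS mulf_neq0 ?IH ?xc_neq0 //; lia.
Qed.

Lemma bprod_neq0 k : (k <= n - 1)%N -> bprod x k != 0.
Proof.
elim: k => [|k IH] hk; first by rewrite bprod0 oner_neq0.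
by rewrite bprodS mulf_neq0 ?IH ?xb_neq0 //; lia.
Qed.

Lemma levelE : level x = xprod x n * bprod x (n - 1).
Proof. by rewrite /level /bprod subn1 prednK //; lia. Qed.

Lemma level_neq0 : level x != 0.
Proof. by rewrite levelE mulf_neq0 ?xprod_neq0 ?bprod_neq0. Qed.

(** The factor [(1 < k)%:R] absorbs the special form of the first entry, so that
    the index 1 needs no separate treatment later on. *)
Lemma Mcol1_low k : (1 <= k <= n - 1)%N ->
  Mcol1 x k = xprod x k.-1 * ((1 < k)%:R + xc x k / xb x k).
Proof.
case: k => [|[|k]] // hk; rewrite /Mcol1 /=.
  by rewrite xprod0 mul1r add0r.
by rewrite ifT //; lia.
Qed.

Lemma Mcol1_n : Mcol1 x n = xprod x n.
Proof. by rewrite /Mcol1 eqxx 2?ifF //; lia. Qed.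

Lemma Mcol1_nS : Mcol1 x n.+1 = xprod x (n - 1).
Proof.
rewrite /Mcol1 addn1 eqxx 3?ifF //; try lia.
by rewrite /xprod subn1 prednK //; lia.
Qed.

Lemma Mcol1_high k : (k <= n - 2)%N ->
  Mcol1 x (2 * n - k) = level x / bprod x k.
Proof. by move=> hk; rewrite /Mcol1 4?ifF ?subKn //; lia. Qed.

Lemma colfactor_low j : (j <= n)%N -> colfactor x j = (xprod x j.-1)^-1.
Proof. by rewrite /colfactor => ->. Qed.

Lemma colfactor_nS : colfactor x n.+1 = (xprod x n)^-1.
Proof. by rewrite /colfactor ltnn eqxx. Qed.

Lemma colfactor_high k : (k <= n - 2)%N ->
  colfactor x (2 * n - k) =
    bprod x k * ((0 < k)%:R + xb x k.+1 / xc x k.+1) / level x.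
Proof.
move=> hk; rewrite /colfactor 2?ifF ?subKn //; try lia.
by have -> : (2 * n - k < 2 * n)%N = (0 < k)%N by lia.
Qed.

(** One step of the recursion for the columns on the left.  It works since on
    the diagonal [v_j * w_j = (1 < j) + x_j / xbar_j], so that dividing by [x_j]
    and
    adding [u / xbar_j] turns the corrected entry at (j,j) into an entry above
    the diagonal.  The extra factor [e] serves for column n+1, which is derived
    from column n-1 with the divisor [x_(n-1) * x_n]. *)
Lemma ordform_next_column z k j j' s e :
  (1 <= k <= 2 * n)%N -> (1 <= j <= n - 1)%N -> e != 0 ->
  colfactor x j' = colfactor x j / (xc x j * e) ->
  dorder n k j' = dorder n k j || (k == j) ->
  dcorr n z k j' = kd F k s ->
  let u := level x * z - 1 in
  let f := ordform u (Mcol1 x) (colfactor x) (dorder n) (dcorr n z) in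
  f k j / (xc x j * e) + u * (kd F k j / (xb x j * e) + kd F k s) = f k j'.
Proof.
move=> hk hj he hw hU hJ u f; rewrite /f /ordform hw hU hJ.
have xj0 : xc x j != 0 by rewrite xc_neq0 //; lia.
have bj0 : xb x j != 0 by rewrite xb_neq0 //; lia.
rewrite /kd; have [->|nkj] := eqVneq k j.
  have -> : dorder n j j = false by rewrite /dorder ltnn.
  have -> : dcorr n z j j = (1 < j)%:R by apply: dcorrE; rewrite ?dmatchE; lia.
  rewrite Mcol1_low // colfactor_low; last by lia.
  have p0 : xprod x j.-1 != 0 by rewrite xprod_neq0 //; lia.
  by rewrite /=; field; rewrite xj0 bj0 he p0.
rewrite orbF.
have -> : dcorr n z k j = false%:R by apply: dcorrE; rewrite ?dmatchE; lia.
by rewrite /=; field; rewrite xj0 bj0 he.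
Qed.

Lemma Mleft_ordform z k j : (1 <= k <= 2 * n)%N -> (1 <= j <= n - 1)%N ->
  Mleft x z k j
  = ordform (level x * z - 1) (Mcol1 x) (colfactor x) (dorder n) (dcorr n z) k j.
Proof.
move=> hk; case: j => // j; elim: j => [|j IH] hj.
  have -> : Mleft x z k 1 = Mcol1 x k by [].
  rewrite /ordform colfactor_low ?xprod0; last by lia.
  have -> : dorder n k 1 = false by rewrite /dorder; lia.
  have -> : dcorr n z k 1 = false%:R by apply: dcorrE; rewrite ?dmatchE; lia.
  by rewrite invr1 /=; ring.
rewrite -(@ordform_next_column z k j.+1 j.+2 j.+2 1) ?oner_neq0 ?mulr1 //.
- by rewrite -IH //; lia.
- by lia.
- by rewrite !colfactor_low /= ?xprodS ?invfM ?mulr1 //; lia.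
- by rewrite /dorder; lia.
- by apply: dcorrE; rewrite ?dmatchE; lia.
Qed.

(** On the right the recursion starts from [level x * z * v_k * w_j] in all rows.
    In the lower rows [v_(2n-k) = level / bprod k], so that the deltas
    accumulated up to column j take away [u * v_k * w_j] below the diagonal and,
    before the last column, [u * (v_j * w_j - 1)] on it. *)
Lemma Mright_ordform z k j : (1 <= k <= 2 * n)%N -> (j <= n - 2)%N ->
  (forall m, (2 <= m <= n - 2)%N -> barX x m != 0) ->
  Mright x z k j
  = ordform (level x * z - 1) (Mcol1 x) (colfactor x) (dorder n) (dcorr n z) k
      (2 * n - j).
Proof.
move=> hk + hX; have l0 := level_neq0.
have x1 : xc x 1 != 0 by rewrite xc_neq0 //; lia.
have x2 : xc x 2 != 0 by rewrite xc_neq0 //; lia.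
have b1 : xb x 1 != 0 by rewrite xb_neq0 //; lia.
elim: j => [|[|j] IH] hj.
- rewrite /ordform colfactor_high // bprod0 subn0 /= /kd /dcorr /dorder.
  have [->|k1] := eqVneq k 1%N.
    rewrite Mcol1_low ?xprod0 ?eqxx /=; last by lia.
    have -> : (1 == 2 * n)%N = false by lia.
    have -> : (1 < 2 * n)%N && ~~ ((1 == n)%N && (2 * n == n.+1)%N) by lia.
    by rewrite /=; field; rewrite x1 b1 l0.
  have [->|k2] := eqVneq k (2 * n)%N.
    have := @Mcol1_high 0 isT; rewrite subn0 bprod0 divr1 => ->.
    rewrite ltnn andbF /=.
    by field; rewrite x1 l0.
  have -> : (k < 2 * n)%N && ~~ ((k == n)%N && (2 * n == n.+1)%N) by lia.
  have -> : (1 < k < 2 * n)%N && dmatch n k (2 * n) = false.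
    by rewrite dmatchE; lia.
  by rewrite /=; field; rewrite x1 l0.
- rewrite /ordform colfactor_high //.
  rewrite bprodS bprod0 mul1r /= /kd /dcorr /dorder /barX.
  have -> : (k == 1%N) && (2 * n - 1 == 2 * n)%N = false by lia.
  have [->|k2] := eqVneq k (2 * n)%N.
    have := @Mcol1_high 0 isT; rewrite subn0 bprod0 divr1 => ->.
    have -> : (2 * n == 2 * n - 1)%N = false by lia.
    have -> : (2 * n < 2 * n - 1)%N = false by lia.
    by rewrite ltnn andbF /=; field; rewrite x2 l0.
  have [->|k1] := eqVneq k (2 * n - 1)%N.
    rewrite Mcol1_high // bprodS bprod0 mul1r ltnn.
    have -> : (1 < 2 * n - 1 < 2 * n)%N && dmatch n (2 * n - 1) (2 * n - 1).
      by rewrite dmatchE; lia.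
    by rewrite /=; field; rewrite x2 b1 l0.
  have -> : (k < 2 * n - 1)%N && ~~ ((k == n) && (2 * n - 1 == n.+1)%N) by lia.
  have -> : (1 < k < 2 * n)%N && dmatch n k (2 * n - 1) = false.
    by rewrite dmatchE; lia.
  by rewrite /=; field; rewrite x2 l0.
- (* Naming the column offset keeps [/=] from unfolding it. *)
  have [m Em] : exists m, m = j.+2 by exists j.+2.
  rewrite -Em.
  have hm : (2 <= m <= n - 2)%N by rewrite Em.
  have -> : Mright x z k m =
      xb x m * (barX x m.+1 / barX x m) * Mright x z k j.+1
      + (1 - level x * z) *
        (kd F k (2 * n + 1 - m) * xb x m * (barX x m.+1 / barX x m)
         + kd F k (2 * n - m) * (xb x m.+1 / xc x m.+1)) by rewrite Em.
  rewrite IH; last by lia.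
  have Xm := hX m hm; clear IH hX.
  have xm : xc x m != 0 by rewrite xc_neq0 //; lia.
  have xm1 : xc x m.+1 != 0 by rewrite xc_neq0 //; lia.
  have bm : xb x m != 0 by rewrite xb_neq0 //; lia.
  have bj : bprod x j.+1 != 0 by rewrite bprod_neq0 //; lia.
  have {}Xm : xc x m + xb x m != 0.
    apply: contraNneq Xm => e; rewrite /barX.
    by rewrite -[1](@divff _ (xc x m)) // -mulrDl e mul0r.
  rewrite /ordform Em !colfactor_high ?(bprodS j.+1) -?Em /=; try index_lia.
  rewrite /kd /barX.
  have -> : (0 < m)%N by index_lia.
  have -> : dcorr n z k (2 * n - j.+1) = (k == 2 * n - j.+1)%N%:R.
    by apply: dcorrE; rewrite ?dmatchE; index_lia.
  have -> : dcorr n z k (2 * n - m) = (k == 2 * n - m)%N%:R.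
    by apply: dcorrE; rewrite ?dmatchE; index_lia.
  have -> : (2 * n + 1 - m = 2 * n - j.+1)%N by index_lia.
  have [->|k1] := eqVneq k (2 * n - j.+1)%N.
    rewrite Mcol1_high; last by index_lia.
    have -> : dorder n (2 * n - j.+1) (2 * n - j.+1) = false.
      by rewrite /dorder; index_lia.
    have -> : dorder n (2 * n - j.+1) (2 * n - m) = false.
      by rewrite /dorder; index_lia.
    have -> : (2 * n - j.+1 == 2 * n - m)%N = false by index_lia.
    by rewrite /=; field; rewrite xm xm1 Xm bj l0.
  have [->|k2] := eqVneq k (2 * n - m)%N.
    rewrite Mcol1_high ?[in bprod x m]Em ?(bprodS j.+1) -?Em //; try index_lia.
    have -> : dorder n (2 * n - m) (2 * n - j.+1) by rewrite /dorder; index_lia.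
    have -> : dorder n (2 * n - m) (2 * n - m) = false.
      by rewrite /dorder; index_lia.
    by rewrite /=; field; rewrite xm xm1 Xm bj bm l0.
  have -> : dorder n k (2 * n - j.+1) = dorder n k (2 * n - m).
    by rewrite /dorder; index_lia.
  by rewrite /=; field; rewrite xm xm1 Xm l0.
Qed.

Lemma M_ordform z : M x z =
  \matrix_(k < 2 * n, j < 2 * n)
    ordform (level x * z - 1) (Mcol1 x) (colfactor x) (dorder n) (dcorr n z)
      k.+1 j.+1.
Proof.
apply/matrixP=> k' j'; rewrite !mxE; move: (ltn_ord k') (ltn_ord j').
move: {k'}(k'.+1) {j'}(j'.+1) (ltn0Sn k') (ltn0Sn j') => k j k0 j0 k1 j1.
have hk : (1 <= k <= 2 * n)%N by rewrite k0.
have xn : xc x n != 0 by rewrite xc_neq0 //; lia.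
rewrite /Mentry; case: leqP => hj1; first by apply: Mleft_ordform; lia.
have hn1 : (1 <= n - 1 <= n - 1)%N by lia.
have nP : n.-1 = (n - 1)%N by lia.
have nK : (n - 1).+1 = n by lia.
have pK : xprod x (n - 1).-1 * xc x (n - 1) = xprod x (n - 1).
  by rewrite -[in RHS](@prednK (n - 1)) ?xprodS ?prednK //; lia.
have xp : xprod x n = xprod x (n - 1) * xc x n.
  by have := xprodS (n - 1); rewrite nK.
case: eqP => [->|hj2].
  rewrite -(@ordform_next_column z k (n - 1) n n.+1 1)
    ?oner_neq0 // ?mulr1 ?addn1.
  - by rewrite Mleft_ordform.
  - by rewrite !colfactor_low ?nP -?pK ?invfM //; lia.
  - by rewrite /dorder; lia.
  - by apply: dcorrE; rewrite ?dmatchE; lia.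
case: eqP => [->|hj3].
  rewrite addn1 -(@ordform_next_column z k (n - 1) n.+1 n (xc x n)) //.
  - by rewrite Mleft_ordform.
  - by rewrite colfactor_nS colfactor_low ?xp -?pK ?invfM ?mulrA //; lia.
  - by rewrite /dorder; lia.
  - by apply: dcorrE; rewrite ?dmatchE; lia.
by rewrite Mright_ordform ?subKn //; try lia; case: hM.
Qed.
End ClosedForm.

(** * The crystal operators as rescalings *)

Lemma prod_rescale2 (F : fieldType) (f g : nat -> F) (i : nat) (s t : F)
    (N k : nat) :
  (1 <= i)%N -> (k <= N)%N ->
  (forall m, (1 <= m <= N)%N ->
     f m = (if m == i then s else 1) * (if m == i.+1 then t else 1) * g m) ->
  \prod_(1 <= m < k.+1) f m =
    (if (i <= k)%N then s else 1) * (if (i < k)%N then t else 1)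
    * \prod_(1 <= m < k.+1) g m.
Proof.
move=> hi + hf; elim: k => [|k IH] hk.
  by rewrite !big_geq // leqNgt hi !mul1r.
rewrite !(@big_nat_recr _ _ _ k.+1) //= IH ?hf; [|lia|lia].
have step a (y : F) : (if (a <= k.+1)%N then y else 1)
    = (if (a <= k)%N then y else 1) * (if k.+1 == a then y else 1).
  case: (ltngtP k.+1 a) => [h|h|<-]; rewrite ?ltnn ?mul1r //.
    by rewrite ifF ?mul1r //; lia.
  by rewrite ifT ?mulr1 //; lia.
by rewrite (step i) (step i.+1); ring.
Qed.

Lemma index_cases (n k : nat) : (4 <= n)%N -> (1 <= k <= 2 * n)%N ->
  [\/ (1 <= k <= n - 1)%N, k = n, k = n.+1
    | exists2 m, (m <= n - 2)%N & k = (2 * n - m)%N].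
Proof.
move=> hn hk; have [h|h] := leqP k (n - 1); first by constructor 1; lia.
have [->|h1] := eqVneq k n; first by constructor 2.
have [->|h2] := eqVneq k n.+1; first by constructor 3.
by constructor 4; exists (2 * n - k)%N; lia.
Qed.

Section Rescaling.
Variables (F : fieldType) (n : nat).
Implicit Types x y : point F n.

(** All the operators e_i^c have this form, with i the left one of two adjacent
    sites; products of coordinates then change by at most two factors. *)
Definition rescaled (i : nat) (s1 s2 t1 t2 : F) x y : Prop :=
  (forall j, (1 <= j <= n)%N ->
     xc y j = (if j == i then s1 else 1)
              * (if j == i.+1 then s2 else 1) * xc x j)
  /\ (forall j, (1 <= j <= n - 1)%N ->
     xb y j = (if j == i then t1 else 1)
              * (if j == i.+1 then t2 else 1) * xb x j).

Lemma xprod_rescaled i s1 s2 t1 t2 x y k :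
  rescaled i s1 s2 t1 t2 x y -> (1 <= i)%N -> (k <= n)%N ->
  xprod y k = (if (i <= k)%N then s1 else 1) * (if (i < k)%N then s2 else 1)
              * xprod x k.
Proof. by move=> [h _] hi hk; apply: prod_rescale2 h. Qed.

Lemma bprod_rescaled i s1 s2 t1 t2 x y k :
  rescaled i s1 s2 t1 t2 x y -> (1 <= i)%N -> (k <= n - 1)%N ->
  bprod y k = (if (i <= k)%N then t1 else 1) * (if (i < k)%N then t2 else 1)
              * bprod x k.
Proof. by move=> [_ h] hi hk; apply: prod_rescale2 h. Qed.

Lemma geom_e_rescaled_zero c x : (4 <= n)%N ->
  rescaled 1 (xi c x 2)^-1 (c^-1 * xi c x 2) (c * (xi c x 2)^-1) (xi c x 2)
    x (geom_e 0 c x).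
Proof.
move=> hn; rewrite /geom_e; split=> j hj; rewrite ?xc_mkpoint ?xb_mkpoint //=;
  by case: eqP => [->|_] /=; [|case: eqP => [->|_]]; rewrite ?mulr1 ?mul1r.
Qed.

Lemma geom_e_rescaled_mid i c x : (1 <= i <= n - 2)%N ->
  rescaled i (c * (xi c x i.+1)^-1) (c^-1 * xi c x i.+1)
    (xi c x i.+1)^-1 (xi c x i.+1) x (geom_e i c x).
Proof.
move=> hi; have i0 : (i == 0%N) = false by lia.
have [i1 i2] : (1 <= i)%N /\ (i <= n - 2)%N by lia.
rewrite /geom_e i0 i2.
have ni : (i == i.+1) = false by lia.
split=> j hj; rewrite ?xc_mkpoint ?xb_mkpoint //=;
  by case: eqP => [->|_] /=; rewrite ?ni; [|case: eqP => [->|_]];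
     rewrite ?mulr1 ?mul1r.
Qed.

Lemma geom_e_rescaled_pred c x : (4 <= n)%N ->
  rescaled (n - 1) c c^-1 1 1 x (geom_e (n - 1) c x).
Proof.
move=> hn.
have n0 : (n - 1 == 0)%N = false by lia.
have n2 : (n - 1 <= n - 2)%N = false by lia.
rewrite /geom_e n0 n2 eqxx.
have nK : (n - 1).+1 = n by lia.
have ni : (n - 1 == n)%N = false by lia.
split=> j hj; rewrite ?xc_mkpoint ?xb_mkpoint //= nK.
  by case: eqP => [->|_] /=; rewrite ?ni; [|case: eqP => [->|_]];
     rewrite ?mulr1 ?mul1r.
by rewrite !if_same !mul1r.
Qed.

Lemma geom_e_rescaled_last c x : (4 <= n)%N ->
  rescaled (n - 1) 1 c c^-1 1 x (geom_e n c x).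
Proof.
move=> hn.
have n0 : (n == 0)%N = false by lia.
have n2 : (n <= n - 2)%N = false by lia.
have n1 : (n == n - 1)%N = false by lia.
rewrite /geom_e n0 n2 n1.
have nK : (n - 1).+1 = n by lia.
split=> j hj; rewrite ?xc_mkpoint ?xb_mkpoint //= nK if_same ?mul1r ?mulr1.
  by case: eqP => [->|_] /=; rewrite ?mul1r.
by case: eqP => [->|_] /=; rewrite ?mul1r.
Qed.
End Rescaling.

(** * Positions of the simple roots in the order *)

Definition indices (n : nat) : pred nat := [pred k | (1 <= k <= 2 * n)%N].

Lemma dcorr_eq0 (F : fieldType) n (z : F) k j :
  ~~ ((k == 1%N) && (j == (2 * n)%N)) ->
  ~~ ((1 < k < 2 * n)%N && dmatch n k j) -> dcorr n z k j = 0.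
Proof. by move=> h1 /negPf h2; apply: (@dcorrE _ _ _ _ _ false). Qed.

(** In the affine setting the order is cyclic; this is its rotation by two steps. *)
Definition turn (n k : nat) : nat := (k + 2 * n * (k <= 2))%N.

Definition dorder_turn (n k j : nat) : bool :=
  [&& (turn n k < turn n j)%N, ~~ ((k == n) && (j == n.+1))
    & ~~ ((k == (2 * n)%N) && (j == 1%N))].

(** In the turned order 1 and 2n are incomparable, and the two corresponding
    positions carry z and 1/z just as (n,n+1) and (n+1,n) carry 1 and 1. *)
Definition dcorr_turn (F : fieldType) (n : nat) (z : F) (k j : nat) : F :=
  if (k == (2 * n)%N) && (j == 1%N) then z^-1 else dcorr n z k j.

Lemma dcorr_turn_eq0 (F : fieldType) n (z : F) k j :
  ~~ ((k == (2 * n)%N) && (j == 1%N)) -> ~~ ((k == 1%N) && (j == (2 * n)%N)) ->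
  ~~ ((1 < k < 2 * n)%N && dmatch n k j) -> dcorr_turn n z k j = 0.
Proof. by rewrite /dcorr_turn => /negPf-> *; apply: dcorr_eq0. Qed.

Ltac prove_adapted :=
  split; [ by rewrite !inE; split; lia
         | by rewrite /= !inE; lia
         | split; [ by rewrite /dorder_turn /dorder /turn; split; lia
                  | by move=> m _; rewrite /dorder_turn /dorder ltnn ]
         | split; [ by rewrite /dorder_turn /dorder /turn; split; lia
                  | by split; first [apply: dcorr_turn_eq0 | apply: dcorr_eq0];
                       rewrite ?dmatchE; lia ]
         | by move=> m; rewrite inE => hm; split=> *; split;
              first [ by rewrite /dorder_turn /dorder /turn; lia
                    | by first [apply: dcorr_turn_eq0 | apply: dcorr_eq0];
                         rewrite ?dmatchE; lia ] ].

Lemma adapted_mid (F : fieldType) n (z : F) i :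
  (4 <= n)%N -> (1 <= i <= n - 2)%N ->
  adapted (indices n) (dorder n) (dcorr n z) i i.+1 (2 * n - i) (2 * n - i.-1).
Proof. by move=> hn hi; prove_adapted. Qed.

Lemma adapted_pred (F : fieldType) n (z : F) : (4 <= n)%N ->
  adapted (indices n) (dorder n) (dcorr n z) (n - 1) n n.+1 n.+2.
Proof. by move=> hn; prove_adapted. Qed.

Lemma adapted_last (F : fieldType) n (z : F) : (4 <= n)%N ->
  adapted (indices n) (dorder n) (dcorr n z) (n - 1) n.+1 n n.+2.
Proof. by move=> hn; prove_adapted. Qed.

Lemma adapted_turn (F : fieldType) n (z : F) : (4 <= n)%N ->
  adapted (indices n) (dorder_turn n) (dcorr_turn n z) (2 * n - 1) 1 (2 * n) 2.
Proof. by move=> hn; prove_adapted. Qed.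

(** * The operators with index at least 1 *)

Lemma matrix_ordform_transvections (F : fieldType) n (A B : 'M[F]_(2 * n))
    u v w v' w' (U : rel nat) J p q r t a b :
  A = \matrix_(k < 2 * n, j < 2 * n) ordform u v w U J k.+1 j.+1 ->
  B = \matrix_(k < 2 * n, j < 2 * n) ordform u v' w' U J k.+1 j.+1 ->
  adapted (indices n) U J p q r t ->
  J q r = (1 - (U q r)%:R) * (v q * w r) ->
  a * (J q q - v q * w q) + b * (J p p - v p * w p) = a * b * (v q * w p) ->
  a * (J t t - v t * w t) + b * (J r r - v r * w r) = a * b * (v t * w r) ->
  {in indices n, forall k,
     v' k = v k + a * ((k == p)%:R * v q + (k == r)%:R * v t)} ->
  {in indices n, forall j,
     w' j = w j + b * ((j == q)%:R * w p + (j == t)%:R * w r)} ->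
  (1%:M + a *: (Eunit F n p q + Eunit F n r t)) *m A
    *m (1%:M + b *: (Eunit F n p q + Eunit F n r t)) = B.
Proof.
move=> -> -> adp Jqr epq ert hv hw.
have [[hp hq hr ht] _ _ _ _] := adp; rewrite !inE in hp hq hr ht.
rewrite transvections_mulmx //; apply/matrixP=> k j; rewrite !mxE.
by apply: (ordform_transvections u adp) => //; rewrite inE ltn_ord.
Qed.

(** The chain case p < q < r < t: the nodes i and i+1 and their mirror images.
    [x_i x_(i+1)] and [xbar_i xbar_(i+1)] are invariant, so [v] changes only at
    the indices i and 2n-i, and [w] only at i+1 and 2n+1-i. *)
Lemma transvections_M_mid (F : fieldType) (n : nat) (hn : (4 <= n)%N)
    (i : nat) (hi : (1 <= i <= n - 2)%N) (x y : point F n) (c z : F)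
    (hMx : M_defined x) (hMy : M_defined y)
    (c0 : c != 0) (s0 : xc x i.+1 + xb x i.+1 != 0)
    (d0 : xc x i.+1 + c * xb x i.+1 != 0) :
  rescaled i (c * (xi c x i.+1)^-1) (c^-1 * xi c x i.+1)
    (xi c x i.+1)^-1 (xi c x i.+1) x y ->
  G n i ((c - 1) / epsilon i x) *m M x z *m G n i ((c^-1 - 1) / phi i x)
  = M y z.
Proof.
move=> resc.
have i0 : (i == 0%N) = false by lia.
have [imid iltn] : (i <= n - 2)%N /\ (i < n)%N by lia.
have xi0 : xc x i != 0 by rewrite xc_neq0 //; lia.
have xi1 : xc x i.+1 != 0 by rewrite xc_neq0 //; lia.
have bi0 : xb x i != 0 by rewrite xb_neq0 //; lia.
have bi1 : xb x i.+1 != 0 by rewrite xb_neq0 //; lia.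
have l0 := level_neq0 hn hMx.
have xp k : (k <= n)%N -> xprod y k =
    (if k == i then c * (xi c x i.+1)^-1 else 1) * xprod x k.
  move=> hk; rewrite (xprod_rescaled resc) //; last by lia.
  case: (ltngtP k i) => h /=; rewrite ?mulr1 ?mul1r //.
  rewrite -[RHS]mul1r; congr (_ * _); rewrite /xi; field.
  by rewrite c0 d0 s0.
have bp k : (k <= n - 1)%N -> bprod y k =
    (if k == i then (xi c x i.+1)^-1 else 1) * bprod x k.
  move=> hk; rewrite (bprod_rescaled resc) //; last by lia.
  case: (ltngtP k i) => h /=; rewrite ?mulr1 ?mul1r //.
  by rewrite /xi mulVf ?mul1r // mulf_neq0 ?invr_eq0.
have lv : level y = level x.
  by rewrite !levelE // xp // bp // !ifF ?mul1r //; index_lia.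
have [rx rb] := resc.
have iK : i.-1.+1 = i by index_lia.
have xpi : xprod x i = xprod x i.-1 * xc x i by rewrite -{1}iK xprodS iK.
have bpi : bprod x i = bprod x i.-1 * xb x i by rewrite -{1}iK bprodS iK.
have P0 : xprod x i.-1 != 0 by rewrite xprod_neq0 //; index_lia.
have Q0 : bprod x i.-1 != 0 by rewrite bprod_neq0 //; index_lia.
rewrite /G i0 iltn.
have -> : (2 * n + 1 - i = 2 * n - i.-1)%N by index_lia.
have vw : [/\ Mcol1 x i = xprod x i.-1 * ((1 < i)%:R + xc x i / xb x i),
    Mcol1 x i.+1 = xprod x i * (1 + xc x i.+1 / xb x i.+1),
    Mcol1 x (2 * n - i) = level x / bprod x i
    & Mcol1 x (2 * n - i.-1) = level x / bprod x i.-1].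
  have i1 : (1 < i.+1)%N by index_lia.
  split; [rewrite Mcol1_low | rewrite Mcol1_low ?i1 | rewrite Mcol1_high
         | rewrite Mcol1_high] => //; index_lia.
have ww : [/\ colfactor x i = (xprod x i.-1)^-1,
    colfactor x i.+1 = (xprod x i)^-1,
    colfactor x (2 * n - i) = bprod x i * (1 + xb x i.+1 / xc x i.+1) / level x
    & colfactor x (2 * n - i.-1) =
      bprod x i.-1 * ((1 < i)%:R + xb x i / xc x i) / level x].
  split; [rewrite colfactor_low | rewrite colfactor_low | rewrite colfactor_high
         | rewrite colfactor_high] => //; try index_lia.
    by have -> : (0 < i)%N by index_lia.
  by rewrite iK; have -> : (0 < i.-1)%N = (1 < i)%N by index_lia.
have JJ : [/\ dcorr n z i i = (1 < i)%:R, dcorr n z i.+1 i.+1 = 1,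
    dcorr n z (2 * n - i) (2 * n - i) = 1
    & dcorr n z (2 * n - i.-1) (2 * n - i.-1) = (1 < i)%:R].
  split; first [apply: dcorrE | apply: (@dcorrE _ _ _ _ _ true)];
    rewrite ?dmatchE; index_lia.
have eps : (c - 1) / epsilon i x
   = (c - 1) * xb x i.+1 / (xb x i * (xc x i.+1 + xb x i.+1)).
  by rewrite /epsilon i0 imid; field; rewrite bi0 bi1 s0.
have ph : (c^-1 - 1) / phi i x
   = (c^-1 - 1) * xc x i.+1 / (xc x i * (xc x i.+1 + xb x i.+1)).
  by rewrite /phi i0 imid; field; rewrite c0 xi0 xi1 s0.
rewrite {}eps {}ph.
case: vw => vp vq vr vt; case: ww => wp wq wr wt; case: JJ => Jp Jq Jr Jt.
have My := M_ordform hn hMy z; rewrite lv in My.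
apply: (matrix_ordform_transvections (M_ordform hn hMx z) My
         (adapted_mid z hn hi)).
- have -> : dorder n i.+1 (2 * n - i) by rewrite /dorder; index_lia.
  by rewrite dcorr_eq0 ?dmatchE /= ?subrr ?mul0r //; index_lia.
- rewrite Jp Jq vq vp wq wp xpi; field.
  by rewrite xi0 bi0 bi1 s0 c0 P0.
- rewrite Jt Jr vt vr wt wr bpi; field.
  by rewrite xi0 xi1 bi0 s0 c0 Q0 l0.
- move=> k; rewrite inE => /(index_cases hn) [hk|->|->|[m hm ->]].
  + have nkr : (k == 2 * n - i)%N = false by index_lia.
    rewrite nkr mul0r addr0 Mcol1_low // xp; last by index_lia.
    rewrite rx ?rb; try index_lia.
    have [->|nki] := eqVneq k i.
      have -> : (i.-1 == i) = false by index_lia.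
      have -> : (i == i.+1) = false by index_lia.
      rewrite vp vq xpi /xi /=; field.
      by rewrite bi0 bi1 s0 d0.
    rewrite mul0r mulr0 addr0 Mcol1_low //.
    have [->|nki1] := eqVneq k i.+1.
      have -> : (1 < i.+1)%N by index_lia.
      rewrite /= eqxx /xi.
      by field; rewrite c0 bi1 s0 d0.
    have -> : (k.-1 == i) = false by index_lia.
    by rewrite !mul1r.
  + have -> : (n == i) = false by index_lia.
    have -> : (n == 2 * n - i)%N = false by index_lia.
    rewrite !Mcol1_n // xp //.
    have -> : (n == i) = false by index_lia.
    by rewrite /=; ring.
  + have -> : (n.+1 == i) = false by index_lia.
    have -> : (n.+1 == 2 * n - i)%N = false by index_lia.
    rewrite !Mcol1_nS // xp; last by index_lia.
    have -> : (n - 1 == i)%N = false by index_lia.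
    by rewrite /=; ring.
  + have -> : (2 * n - m == i)%N = false by index_lia.
    have -> : (2 * n - m == 2 * n - i)%N = (m == i) by index_lia.
    rewrite Mcol1_high // lv bp; last by index_lia.
    have [->|nmi] := eqVneq m i.
      rewrite vr vt bpi /xi /=; field.
      by rewrite bi0 s0 d0 Q0.
    by rewrite Mcol1_high //= mul1r; ring.
- move=> j; rewrite inE => hj.
  have [jn|jn] := leqP j n.
    have -> : (j == 2 * n - i.-1)%N = false by index_lia.
    rewrite colfactor_low // xp; last by index_lia.
    have [->|nji] := eqVneq j i.+1.
      rewrite wp wq xpi /= eqxx /xi; field.
      by rewrite xi0 s0 d0 c0 P0.
    have -> : (j.-1 == i) = false by index_lia.
    by rewrite colfactor_low //= mul1r; ring.
  have -> : (j == i.+1) = false by index_lia.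
  case: (index_cases hn hj) => [?|?|->|[m hm ->]]; [index_lia..| |].
    have -> : (n.+1 == 2 * n - i.-1)%N = false by index_lia.
    rewrite !colfactor_nS // xp //; have -> : (n == i) = false by index_lia.
    by rewrite /= mul1r; ring.
  have -> : (2 * n - m == 2 * n - i.-1)%N = (m == i.-1) by index_lia.
  rewrite colfactor_high // lv bp ?rx ?rb; [|index_lia..].
  have [->|nmi] := eqVneq m i.-1.
    have -> : (i.-1 == i) = false by index_lia.
    rewrite iK eqxx wr wt bpi /xi; have -> : (i == i.+1) = false by index_lia.
    have -> : (0 < i.-1)%N = (1 < i)%N by index_lia.
    by rewrite /=; field; rewrite xi0 xi1 c0 s0 d0 l0.
  rewrite colfactor_high //; have -> : (m.+1 == i) = false by index_lia.
  rewrite eqSS; have [->|nmi1] := eqVneq m i.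
    have -> : (0 < i)%N by index_lia.
    by rewrite /xi /=; field; rewrite xi0 xi1 c0 s0 d0 l0.
  by rewrite /= !mul1r; ring.
Qed.

(** The four indices n-1, n, n+1, n+2, for n = g+2, form a diamond for the
    order. *)
Section Fork.
Variables (F : fieldType) (g : nat) (x : point F g.+2).
Hypotheses (hn : (4 <= g.+2)%N) (hM : M_defined x).

Lemma fork_neq0 : [/\ xc x g.+1 != 0, xc x g.+2 != 0, xb x g.+1 != 0,
  xprod x g != 0 & bprod x g != 0].
Proof.
by split; rewrite ?xc_neq0 ?xb_neq0 ?xprod_neq0 ?bprod_neq0 //; lia.
Qed.

Lemma fork_level :
  level x = xprod x g * xc x g.+1 * xc x g.+2 * (bprod x g * xb x g.+1).
Proof. by rewrite levelE // subn1 bprodS !xprodS. Qed.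

Lemma fork_rows : [/\ Mcol1 x g.+1 = xprod x g * (1 + xc x g.+1 / xb x g.+1),
  Mcol1 x g.+2 = xprod x g * xc x g.+1 * xc x g.+2,
  Mcol1 x g.+3 = xprod x g * xc x g.+1
  & Mcol1 x g.+4 = level x / bprod x g].
Proof.
have g1 : (1 < g.+1)%N by lia.
have n2 : (g.+4 = 2 * g.+2 - g)%N by lia.
split.
- by rewrite Mcol1_low // ?g1 //; lia.
- by rewrite Mcol1_n // !xprodS.
- by rewrite Mcol1_nS // subn1 xprodS.
- by rewrite n2 Mcol1_high //; lia.
Qed.

Lemma fork_cols : [/\ colfactor x g.+1 = (xprod x g)^-1,
  colfactor x g.+2 = (xprod x g * xc x g.+1)^-1,
  colfactor x g.+3 = (xprod x g * xc x g.+1 * xc x g.+2)^-1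
  & colfactor x g.+4 = bprod x g * (1 + xb x g.+1 / xc x g.+1) / level x].
Proof.
have n2 : (g.+4 = 2 * g.+2 - g)%N by lia.
have g0 : (0 < g)%N by lia.
split.
- by rewrite colfactor_low //; lia.
- by rewrite colfactor_low // xprodS.
- by rewrite colfactor_nS // !xprodS.
- by rewrite n2 colfactor_high ?g0 //; lia.
Qed.
End Fork.

(** The diamond with q = n and r = n+1.  The correction vanishes on the diagonal
    at q and r, and its value at (n,n+1) is [v_n * w_(n+1) = 1]. *)
Lemma transvections_M_pred (F : fieldType) (g : nat) (n := g.+2)
    (hn : (4 <= n)%N) (x y : point F n) (c z : F)
    (hMx : M_defined x) (hMy : M_defined y) (c0 : c != 0) :
  rescaled g.+1 c c^-1 1 1 x y ->
  G n g.+1 ((c - 1) / epsilon g.+1 x) *m M x z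
    *m G n g.+1 ((c^-1 - 1) / phi g.+1 x)
  = M y z.
Proof.
rewrite {}/n in hn x y hMx hMy *; move=> resc; set n := g.+2 in hn *.
have n1 : (n - 1)%N = g.+1 by rewrite /n; index_lia.
have [x1 x2 b1 P0 Q0] := fork_neq0 hn hMx.
have l0 := level_neq0 hn hMx.
have xp k : (k <= n)%N ->
    xprod y k = (if k == g.+1 then c else 1) * xprod x k.
  move=> hk; rewrite (xprod_rescaled resc) //.
  by case: (ltngtP k g.+1) => h /=; rewrite ?mulr1 ?mul1r // mulfV ?mul1r.
have bp k : (k <= n - 1)%N -> bprod y k = bprod x k.
  by move=> hk; rewrite (bprod_rescaled resc) // !if_same !mul1r.
have lv : level y = level x.
  by rewrite !levelE // xp // bp // ifF ?mul1r // /n; index_lia.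
have [rx rb] := resc.
have le := fork_level x hn.
have n2 : (g.+4 = 2 * n - g)%N by rewrite /n; index_lia.
rewrite /G /= ltnSn.
have -> : (2 * n - g.+1 = g.+3)%N by rewrite /n; index_lia.
have -> : (2 * n + 1 - g.+1 = g.+4)%N by rewrite /n; index_lia.
have g1 : (1 < g.+1)%N by rewrite /n in hn; index_lia.
have g0 : (0 < g)%N by [].
have [vp vq vr vt] := fork_rows x hn.
have [wp wq wr wt] := fork_cols x hn.
have adp := adapted_pred z hn; rewrite n1 in adp.
have My := M_ordform hn hMy z; rewrite lv in My.
have eps : epsilon g.+1 x = xc x g.+2 * xb x g.+1.
  rewrite /epsilon n1 eqxx /= ifF //; rewrite /n; index_lia.
have ph : phi g.+1 x = xc x g.+1.
  rewrite /phi n1 eqxx /= ifF //; rewrite /n; index_lia.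
rewrite {}eps {}ph.
apply: (matrix_ordform_transvections (M_ordform hn hMx z) My adp).
- have -> : dorder n g.+2 g.+3 = false by rewrite /dorder /n; index_lia.
  rewrite (@dcorrE _ _ _ _ _ true); [|rewrite ?dmatchE /n; index_lia..].
  by rewrite vq wr /=; field; rewrite x1 x2 P0.
- rewrite (@dcorrE _ _ _ _ _ false); [|rewrite ?dmatchE /n; index_lia..].
  rewrite (@dcorrE _ _ _ _ _ true); [|rewrite ?dmatchE /n; index_lia..].
  by rewrite vq vp wq wp /=; field; rewrite x1 x2 b1 c0 P0.
- rewrite (@dcorrE _ _ _ _ _ true); [|rewrite ?dmatchE /n; index_lia..].
  rewrite (@dcorrE _ _ _ _ _ false); [|rewrite ?dmatchE /n; index_lia..].
  by rewrite vt vr wt wr le /=; field; rewrite x1 x2 b1 c0 P0 Q0.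
- move=> k; rewrite inE => /(index_cases hn) [hk|->|->|[m hm ->]].
  + have -> : (k == g.+3) = false by index_lia.
    rewrite n1 in hk; rewrite Mcol1_low ?n1 // xp ?rx ?rb /n; [|index_lia..].
    have -> : (k.-1 == g.+1) = false by index_lia.
    have -> : (k == g.+2) = false by index_lia.
    rewrite !if_same.
    have [->|nkp] := eqVneq k g.+1.
      rewrite vp vq g1 /=; field.
      by rewrite x2 b1.
    by rewrite Mcol1_low ?n1 // !mul1r /=; ring.
  + have -> : (n == g.+1) = false by rewrite /n; index_lia.
    have -> : (n == g.+3) = false by rewrite /n; index_lia.
    rewrite !Mcol1_n // xp //.
    have -> : (n == g.+1) = false by rewrite /n; index_lia.
    by rewrite /=; ring.
  + have -> : (n.+1 == g.+1) = false by rewrite /n; index_lia.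
    rewrite Mcol1_nS // n1 xp /n ?eqxx; last by index_lia.
    rewrite vr vt le xprodS /=; field.
    by rewrite x2 b1 Q0.
  + have -> : (2 * n - m == g.+1)%N = false by rewrite /n in hm *; index_lia.
    have -> : (2 * n - m == g.+3)%N = false by rewrite /n in hm *; index_lia.
    by rewrite !Mcol1_high // lv bp /n /=; [ring | rewrite /n in hm; index_lia].
- move=> j; rewrite inE => hj.
  have [jn|jn] := leqP j n.
    have -> : (j == g.+4) = false by index_lia.
    rewrite colfactor_low // xp; last by index_lia.
    have [->|njq] := eqVneq j g.+2.
      by rewrite wq wp /= eqxx xprodS; field; rewrite x1 c0 P0.
    have -> : (j.-1 == g.+1) = false by index_lia.
    by rewrite colfactor_low //= mul1r; ring.
  have -> : (j == g.+2) = false by index_lia.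
  case: (index_cases hn hj) => [?|?|->|[m hm ->]]; [index_lia..| |].
    have -> : (n.+1 == g.+4) = false by rewrite /n; index_lia.
    rewrite !colfactor_nS // xp // /n.
    have -> : (g.+2 == g.+1) = false by index_lia.
    by rewrite /= mul1r; ring.
  have -> : (2 * n - m == g.+4)%N = (m == g) by rewrite /n in hm *; index_lia.
  rewrite colfactor_high // lv bp ?rx ?rb /n; [|rewrite /n in hm; index_lia..].
  rewrite !if_same !mul1r eqSS.
  have [->|nmi] := eqVneq m g.
    have -> : (g.+1 == g.+2) = false by index_lia.
    rewrite -/n -n2 wt wr le g0 /=; field.
    by rewrite x1 x2 b1 c0 P0 Q0.
  rewrite colfactor_high //; have -> : (m.+1 == g.+2) = false.
    by rewrite /n in hm; index_lia.
  by rewrite /= !mul1r; ring.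
Qed.

(** The same diamond with the roles of n and n+1 exchanged. *)
Lemma transvections_M_last (F : fieldType) (g : nat) (n := g.+2)
    (hn : (4 <= n)%N) (x y : point F n) (c z : F)
    (hMx : M_defined x) (hMy : M_defined y) (c0 : c != 0) :
  rescaled g.+1 1 c c^-1 1 x y ->
  G n g.+2 ((c - 1) / epsilon g.+2 x) *m M x z
    *m G n g.+2 ((c^-1 - 1) / phi g.+2 x)
  = M y z.
Proof.
rewrite {}/n in hn x y hMx hMy *; move=> resc; set n := g.+2 in hn *.
have n1 : (n - 1)%N = g.+1 by rewrite /n; index_lia.
have [x1 x2 b1 P0 Q0] := fork_neq0 hn hMx.
have l0 := level_neq0 hn hMx.
have xp k : (k <= n)%N ->
    xprod y k = (if k == g.+2 then c else 1) * xprod x k.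
  move=> hk; rewrite (xprod_rescaled resc) // if_same mul1r.
  by case: (ltngtP k g.+2) hk => h hk /=; rewrite ?ifF // ?h //; index_lia.
have bp k : (k <= n - 1)%N ->
    bprod y k = (if k == g.+1 then c^-1 else 1) * bprod x k.
  move=> hk; rewrite (bprod_rescaled resc) // if_same mulr1.
  by case: (ltngtP k g.+1) hk => h hk /=; rewrite ?ifF // ?h //; index_lia.
have lv : level y = level x.
  rewrite !levelE // xp // bp // n1 !eqxx; field; exact: c0.
have [rx rb] := resc.
have le := fork_level x hn.
have n2 : (g.+4 = 2 * n - g)%N by rewrite /n; index_lia.
rewrite /G /= ltnn n1 addn1 addn2.
have g1 : (1 < g.+1)%N by rewrite /n in hn; index_lia.
have g0 : (0 < g)%N by [].
have [vp vq vr vt] := fork_rows x hn.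
have [wp wq wr wt] := fork_cols x hn.
have adp := adapted_last z hn; rewrite n1 in adp.
have My := M_ordform hn hMy z; rewrite lv in My.
have eps : epsilon g.+2 x = xb x g.+1.
  rewrite /epsilon n1 !ifF //; rewrite /n; index_lia.
have ph : phi g.+2 x = xc x g.+1 * xc x g.+2.
  rewrite /phi n1 !ifF //; rewrite /n; index_lia.
rewrite {}eps {}ph.
apply: (matrix_ordform_transvections (M_ordform hn hMx z) My adp).
- have -> : dorder n g.+3 g.+2 = false by rewrite /dorder /n; index_lia.
  rewrite (@dcorrE _ _ _ _ _ true); [|rewrite ?dmatchE /n; index_lia..].
  by rewrite vr wq /=; field; rewrite x1 P0.
- rewrite (@dcorrE _ _ _ _ _ false); [|rewrite ?dmatchE /n; index_lia..].
  rewrite (@dcorrE _ _ _ _ _ true); [|rewrite ?dmatchE /n; index_lia..].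
  by rewrite vr vp wr wp /=; field; rewrite x1 x2 b1 c0 P0.
- rewrite (@dcorrE _ _ _ _ _ true); [|rewrite ?dmatchE /n; index_lia..].
  rewrite (@dcorrE _ _ _ _ _ false); [|rewrite ?dmatchE /n; index_lia..].
  by rewrite vt vq wt wq le /=; field; rewrite x1 x2 b1 c0 P0 Q0.
- move=> k; rewrite inE => /(index_cases hn) [hk|->|->|[m hm ->]].
  + have -> : (k == g.+2) = false by rewrite n1 in hk; index_lia.
    rewrite n1 in hk; rewrite Mcol1_low ?n1 // xp ?rx ?rb /n; [|index_lia..].
    have -> : (k.-1 == g.+2) = false by index_lia.
    have -> : (k == g.+2) = false by index_lia.
    rewrite !if_same.
    have [->|nkp] := eqVneq k g.+1.
      by rewrite vp vr g1 /=; field; rewrite b1 c0.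
    by rewrite Mcol1_low ?n1 // !mul1r /=; ring.
  + have -> : (n == g.+1) = false by rewrite /n; index_lia.
    rewrite Mcol1_n // xp // eqxx.
    by rewrite vt !Mcol1_n // le !xprodS /=; field; rewrite b1 Q0.
  + have -> : (n.+1 == g.+1) = false by rewrite /n; index_lia.
    have -> : (n.+1 == g.+2) = false by rewrite /n; index_lia.
    rewrite !Mcol1_nS // n1 xp /n; last by index_lia.
    have -> : (g.+1 == g.+2) = false by index_lia.
    by rewrite /=; ring.
  + have -> : (2 * n - m == g.+1)%N = false by rewrite /n in hm *; index_lia.
    have -> : (2 * n - m == g.+2)%N = false by rewrite /n in hm *; index_lia.
    rewrite !Mcol1_high // lv bp /n; last by rewrite /n in hm; index_lia.
    have -> : (m == g.+1) = false by rewrite /n in hm; index_lia.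
    by rewrite mul1r /=; ring.
- move=> j; rewrite inE => hj.
  have [jn|jn] := leqP j n.
    have -> : (j == g.+4) = false by index_lia.
    have -> : (j == g.+3) = false by index_lia.
    rewrite !colfactor_low // xp; last by index_lia.
    have -> : (j.-1 == g.+2) = false by rewrite /n in jn; index_lia.
    by rewrite mul1r /=; ring.
  case: (index_cases hn hj) => [?|?|->|[m hm ->]]; [index_lia..| |].
    have -> : (n.+1 == g.+4) = false by rewrite /n; index_lia.
    rewrite colfactor_nS // xp // /n !eqxx wp wr.
    by rewrite !xprodS /=; field; rewrite x1 x2 c0 P0.
  have -> : (2 * n - m == g.+3)%N = false by rewrite /n in hm *; index_lia.
  have -> : (2 * n - m == g.+4)%N = (m == g) by rewrite /n in hm *; index_lia.
  rewrite colfactor_high // lv bp ?rx ?rb /n; [|rewrite /n in hm; index_lia..].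
  have -> : (m == g.+1) = false by rewrite /n in hm; index_lia.
  rewrite !if_same !mul1r eqSS.
  have [->|nmi] := eqVneq m g.
    have -> : (g.+1 == g.+2) = false by index_lia.
    rewrite -/n -n2 wt wq le g0 /=; field.
    by rewrite x1 x2 b1 c0 P0 Q0.
  rewrite colfactor_high //; have -> : (m.+1 == g.+2) = false.
    by rewrite /n in hm; index_lia.
  by rewrite /= !mul1r; ring.
Qed.

(** * The affine operator *)

Section Turned.
Variables (F : fieldType) (n : nat) (x : point F n) (z : F).
Hypotheses (hn : (4 <= n)%N) (hM : M_defined x).

Definition row_turn (k : nat) : F :=
  (if (k <= 2)%N then level x * z else 1) * Mcol1 x k.

Definition col_turn (j : nat) : F :=
  (if (j <= 2)%N then (level x * z)^-1 else 1) * colfactor x j.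

(** Multiplying rows 1 and 2 of the rank-one part by [1 + u] and dividing
    columns 1 and 2 by it reverses the order between {1, 2} and the other
    indices; at (2n,1), which becomes incomparable, the correction 1/z makes up
    for it.  The scale [s] is arbitrary since only products [v_k * w_j] matter;
    it absorbs the factor c by which e_0^c changes the two vectors. *)
Lemma M_ordform_turn (s : F) : z != 0 -> s != 0 -> M x z =
  \matrix_(k < 2 * n, j < 2 * n)
    ordform (level x * z - 1) (fun k => s * row_turn k)
      (fun j => s^-1 * col_turn j) (dorder_turn n) (dcorr_turn n z) k.+1 j.+1.
Proof.
move=> z0 s0; rewrite M_ordform //; apply/matrixP=> k' j'; rewrite !mxE.
move: (ltn_ord k') (ltn_ord j').
move: {k'}(k'.+1) {j'}(j'.+1) (ltn0Sn k') (ltn0Sn j') => k j k0 j0 k1 j1.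
have l0 := level_neq0 hn hM.
rewrite /ordform /row_turn /col_turn /dcorr_turn.
have [/andP[/eqP-> /eqP->]|kj] := boolP ((k == (2 * n)%N) && (j == 1%N)).
  have -> : dorder n (2 * n) 1 = false by rewrite /dorder; index_lia.
  have -> : dorder_turn n (2 * n) 1 = false by rewrite /dorder_turn; index_lia.
  rewrite ifF ?(dcorr_eq0) ?dmatchE; [|index_lia..].
  have := @Mcol1_high _ _ x hn 0 isT; rewrite subn0 bprod0 divr1 => ->.
  rewrite colfactor_low ?xprod0 ?invr1 /=; last by index_lia.
  by field; rewrite s0 z0 l0.
case: (leqP k 2) => hk; case: (leqP j 2) => hj.
- have -> : dorder_turn n k j = dorder n k j.
    by rewrite /dorder_turn /dorder /turn hk hj; index_lia.
  by field; rewrite s0 z0 l0.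
- have -> : dorder_turn n k j = false.
    by rewrite /dorder_turn /turn hk; index_lia.
  have -> : dorder n k j by rewrite /dorder; index_lia.
  by rewrite /=; field; rewrite s0.
- have -> : dorder_turn n k j.
    by rewrite /dorder_turn /turn hj; index_lia.
  have -> : dorder n k j = false by rewrite /dorder; index_lia.
  by rewrite /=; field; rewrite s0 z0 l0.
- have -> : dorder_turn n k j = dorder n k j.
    by rewrite /dorder_turn /dorder /turn; index_lia.
  by field; rewrite s0.
Qed.
End Turned.

(** The diamond 2n-1 < {1, 2n} < 2 of the turned order.  Here [x_1 x_2] is
    divided by c and [xbar_1 xbar_2] is multiplied by c, so that the entries of
    [v] outside 1, 2, 2n-1, 2n are divided by c, which the scale [s = c]
    compensates. *)
Lemma transvections_M_zero (F : fieldType) (n : nat) (hn : (4 <= n)%N)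
    (x y : point F n) (c z : F)
    (hMx : M_defined x) (hMy : M_defined y)
    (c0 : c != 0) (z0 : z != 0) (s0 : xc x 2 + xb x 2 != 0)
    (d0 : xc x 2 + c * xb x 2 != 0) :
  rescaled 1 (xi c x 2)^-1 (c^-1 * xi c x 2) (c * (xi c x 2)^-1) (xi c x 2)
    x y ->
  G n 0 ((c - 1) / (z * epsilon 0 x)) *m M x z
    *m G n 0 ((c^-1 - 1) / (z * phi 0 x))
  = M y z.
Proof.
move=> resc.
have x1 : xc x 1 != 0 by rewrite xc_neq0 //; index_lia.
have x2 : xc x 2 != 0 by rewrite xc_neq0 //; index_lia.
have b1 : xb x 1 != 0 by rewrite xb_neq0 //; index_lia.
have b2 : xb x 2 != 0 by rewrite xb_neq0 //; index_lia.
have l0 := level_neq0 hn hMx.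
have xi0 : xi c x 2 != 0 by rewrite /xi mulf_neq0 ?invr_eq0.
have xp k : (2 <= k <= n)%N -> xprod y k = c^-1 * xprod x k.
  case/andP=> hk hk'; rewrite (xprod_rescaled resc) // hk ifT;
    last by index_lia.
  by congr (_ * _); field; rewrite c0 xi0.
have bp k : (2 <= k <= n - 1)%N -> bprod y k = c * bprod x k.
  case/andP=> hk hk'; rewrite (bprod_rescaled resc) // hk ifT;
    last by index_lia.
  by congr (_ * _); field.
have lv : level y = level x.
  rewrite !levelE // xp ?bp; [|index_lia..].
  by field.
have [rx rb] := resc.
have xp1 : xprod x 1 = xc x 1 by rewrite xprodS xprod0 mul1r.
have bp1 : bprod x 1 = xb x 1 by rewrite bprodS bprod0 mul1r.
have yp1 : xprod y 1 = (xi c x 2)^-1 * xc x 1.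
  by rewrite (xprod_rescaled resc) ?xp1 /= ?mulr1 //; index_lia.
have yb1 : bprod y 1 = c * (xi c x 2)^-1 * xb x 1.
  by rewrite (bprod_rescaled resc) ?bp1 /= ?mulr1 //; index_lia.
have rx1 : xc y 1 = (xi c x 2)^-1 * xc x 1.
  by rewrite rx /= ?mulr1 //; index_lia.
have rx2 : xc y 2 = c^-1 * xi c x 2 * xc x 2.
  by rewrite rx /= ?mul1r //; index_lia.
have rb1 : xb y 1 = c * (xi c x 2)^-1 * xb x 1.
  by rewrite rb /= ?mulr1 //; index_lia.
have rb2 : xb y 2 = xi c x 2 * xb x 2.
  by rewrite rb /= ?mul1r //; index_lia.
have rx3 j : (3 <= j <= n)%N -> xc y j = xc x j.
  move=> hj; rewrite rx; last by index_lia.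
  by rewrite !ifF ?mul1r //; index_lia.
have rb3 j : (3 <= j <= n - 1)%N -> xb y j = xb x j.
  move=> hj; rewrite rb; last by index_lia.
  by rewrite !ifF ?mul1r //; index_lia.
have n20 : (2 * n)%N = (2 * n - 0)%N by rewrite subn0.
have V1 (u : point F n) : Mcol1 u 1 = xc u 1 / xb u 1 by [].
have V2 (u : point F n) : Mcol1 u 2 = xprod u 1 * (1 + xc u 2 / xb u 2).
  by rewrite Mcol1_low //; index_lia.
have Vh1 (u : point F n) : Mcol1 u (2 * n - 1) = level u / bprod u 1.
  by rewrite Mcol1_high //; index_lia.
have Vh0 (u : point F n) : Mcol1 u (2 * n) = level u.
  by rewrite n20 Mcol1_high // bprod0 divr1.
have W1 (u : point F n) : colfactor u 1 = 1.
  by rewrite colfactor_low ?xprod0 ?invr1 //; index_lia.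
have W2 (u : point F n) : colfactor u 2 = (xprod u 1)^-1.
  by rewrite colfactor_low //; index_lia.
have Wh1 (u : point F n) :
    colfactor u (2 * n - 1) = bprod u 1 * (1 + xb u 2 / xc u 2) / level u.
  by rewrite colfactor_high //; index_lia.
have Wh0 (u : point F n) : colfactor u (2 * n) = xb u 1 / xc u 1 / level u.
  by rewrite n20 colfactor_high // bprod0 mul1r add0r.
have h2n : (2 * n <= 2)%N = false by index_lia.
have h2n1 : (2 * n - 1 <= 2)%N = false by index_lia.
have Mx := M_ordform_turn hn hMx z0 (oner_neq0 _).
have My := M_ordform_turn hn hMy z0 c0; rewrite lv in My.
have nz := (x1, x2, b1, b2, s0, d0, c0, z0, l0, xi0).
rewrite /G /=.
have -> : (c - 1) / (z * epsilon 0 x)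
   = (c - 1) * xb x 2 / (z * xc x 1 * (xc x 2 + xb x 2)).
  by rewrite /epsilon /=; field; rewrite !nz.
have -> : (c^-1 - 1) / (z * phi 0 x)
   = (c^-1 - 1) * xc x 2 / (z * xb x 1 * (xc x 2 + xb x 2)).
  by rewrite /phi /=; field; rewrite !nz.
apply: (matrix_ordform_transvections Mx My (adapted_turn z hn));
  rewrite /row_turn /col_turn ?lv ?invr1.
- have -> : dorder_turn n 1 (2 * n) = false.
    by rewrite /dorder_turn /turn; index_lia.
  rewrite /dcorr_turn ifF /dcorr ?eqxx; last by index_lia.
  by rewrite h2n V1 Wh0 /=; field; rewrite !nz.
- rewrite (@dcorr_turn_eq0 _ _ _ 1) ?dmatchE; [|index_lia..].
  rewrite /dcorr_turn ifF; last by index_lia.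
  rewrite (@dcorrE _ _ _ _ _ true) ?dmatchE; [|index_lia..].
  rewrite h2n1 V1 Vh1 W1 Wh1 bp1 /=; field.
  by rewrite !nz.
- rewrite (@dcorr_turn_eq0 _ _ _ (2 * n)) ?dmatchE; [|index_lia..].
  rewrite /dcorr_turn ifF; last by index_lia.
  rewrite (@dcorrE _ _ _ _ _ true) ?dmatchE; [|index_lia..].
  rewrite h2n V2 Vh0 W2 Wh0 xp1 /=; field.
  by rewrite !nz.
- move=> k; rewrite inE => hk.
  have [->|k1] := eqVneq k 1%N.
    have -> : (1 == 2 * n - 1)%N = false by index_lia.
    have -> : (1 == 2 * n)%N = false by index_lia.
    by rewrite !V1 rx1 rb1 /=; field; rewrite !nz.
  have [->|k2] := eqVneq k 2%N.
    have -> : (2 == 2 * n - 1)%N = false by index_lia.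
    have -> : (2 == 2 * n)%N = false by index_lia.
    rewrite !V2 rx2 rb2 yp1 xp1 /xi /=; field.
    by rewrite !nz.
  have -> : (k <= 2)%N = false by index_lia.
  have [->|k3] := eqVneq k (2 * n - 1)%N.
    have -> : (2 * n - 1 == 2 * n)%N = false by index_lia.
    rewrite !Vh1 V1 yb1 lv bp1 /xi /=; field.
    by rewrite !nz.
  have [->|k4] := eqVneq k (2 * n)%N.
    rewrite !Vh0 V2 lv xp1 /=; field.
    by rewrite !nz.
  rewrite !mul0r addr0 mulr0 addr0.
  case: (index_cases hn hk) => [h|->|->|[m hm e]].
  + rewrite !Mcol1_low // xp ?rx3 ?rb3; [|index_lia..].
    by rewrite !mul1r -!mulrA mulVKf.
  + by rewrite !Mcol1_n // xp ?mul1r ?mulVKf //; index_lia.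
  + by rewrite !Mcol1_nS // xp ?mul1r ?mulVKf //; index_lia.
  + rewrite e !Mcol1_high // lv bp; last by index_lia.
    have Q0 : bprod x m != 0 by rewrite bprod_neq0 //; index_lia.
    by field; rewrite Q0 !nz.
- move=> j; rewrite inE => hj.
  have [->|j1] := eqVneq j 1%N.
    rewrite h2n1 !W1 Wh1 bp1 /=; field.
    by rewrite !nz.
  have [->|j2] := eqVneq j 2%N.
    rewrite h2n !W2 Wh0 yp1 xp1 /xi /=; field.
    by rewrite !nz.
  rewrite !mul0r addr0 mulr0 addr0.
  have -> : (j <= 2)%N = false by index_lia.
  have [->|j3] := eqVneq j (2 * n - 1)%N.
    rewrite !Wh1 yb1 rb2 rx2 lv bp1 /xi /=; field.
    by rewrite !nz.
  have [->|j4] := eqVneq j (2 * n)%N.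
    rewrite !Wh0 rb1 rx1 lv /=; field.
    by rewrite !nz.
  have [jn|jn] := leqP j n.
    rewrite !colfactor_low // xp; last by index_lia.
    have P0 : xprod x j.-1 != 0 by rewrite xprod_neq0 //; index_lia.
    by field; rewrite P0 !nz.
  case: (index_cases hn hj) => [?|?|->|[m hm e]]; [index_lia..| |].
    rewrite !colfactor_nS // xp; last by index_lia.
    have P0 : xprod x n != 0 by rewrite xprod_neq0.
    by field; rewrite P0 !nz.
  rewrite e !colfactor_high // lv bp ?rx3 ?rb3; [|index_lia..].
  have xm : xc x m.+1 != 0 by rewrite xc_neq0 //; index_lia.
  by field; rewrite xm !nz.
Qed.

(** * The intertwining identity *)

Theorem theorem3p11 (F : fieldType) (n : nat) (hn : (4 <= n)%N)
    (i : nat) (hi : (i <= n)%N) (x : point F n) (c z : F)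
    (hMx : M_defined x)
    (hex : e_defined i c x)
    (hMex : M_defined (geom_e i c x))
    (heps : z ^+ (i == 0%N) * epsilon i x != 0)
    (hphi : z ^+ (i == 0%N) * phi i x != 0) :
  G n i ((c - 1) / (z ^+ (i == 0%N) * epsilon i x))
    *m M x z
    *m G n i ((c^-1 - 1) / (z ^+ (i == 0%N) * phi i x))
  = M (geom_e i c x) z.
Proof.
have [c0 hxi] := hex.
have split_xi m : xi c x m != 0 -> xc x m + c * xb x m != 0.
  by apply: contraNneq => e; rewrite /xi e mul0r.
have [i0|i0] := eqVneq i 0%N.
  subst i; rewrite !expr1 in heps hphi *.
  have [s0 /split_xi d0] := hxi isT.
  have z0 : z != 0 by apply: contraNneq heps => ->; rewrite mul0r.
  by apply: transvections_M_zero => //; apply: geom_e_rescaled_zero.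
rewrite !expr0 !mul1r; have [imid|iend] := leqP i (n - 2).
  have [] := hxi imid; rewrite (negPf i0) => s0 /split_xi d0.
  have hi2 : (1 <= i <= n - 2)%N by rewrite lt0n i0.
  by apply: transvections_M_mid => //; apply: geom_e_rescaled_mid.
have iE : i = (n - 1)%N \/ i = n by clear -hi iend hn; lia.
clear heps hphi hex hxi i0 hi iend; destruct n as [|[|g]] => //.
have [e | e] := iE; subst i.
  rewrite (subn1 g.+2) /= in hMex *.
  apply: transvections_M_pred => //.
  by have := geom_e_rescaled_pred c x hn; rewrite subn1.
apply: transvections_M_last => //.
by have := geom_e_rescaled_last c x hn; rewrite subn1.
Qed.
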